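(* For every integer $n\geq 1$, $$\sum_{\sigma \in \mathrm{PRW}_{n+1}}u^{\mathrm{M}(\sigma)}v^{\mathrm{des}(\sigma)}w^{\mathrm{asc}(\sigma)}\alpha^{\mathrm{LRmin}(\sigma)+\mathrm{RLmin}(\sigma)-2} =\sum_{\sigma \in \mathrm{PRW}_{n+1}}x^{\mathrm{des}(\sigma)}y^{\mathrm{asc}(\sigma)}\alpha^{\mathrm{LRmin}(\sigma)+\mathrm{RLmin}(\sigma)-2},$$ where $$x=\frac{(w+v)-\sqrt{(w+v)^2-4uvw}}{2}\quad\text{and}\quad y=\frac{(w+v)+\sqrt{(w+v)^2-4uvw}}{2}.$$
   Context: $\mathfrak{S}_n$ is the set of permutations $\sigma=\sigma_1\cdots\sigma_n$ of $[n]=\{1,\dots,n\}$. An index $i\in[n-1]$ is a descent (resp. ascent) of $\sigma$ if $\sigma_i>\sigma_{i+1}$ (resp. $\sigma_i<\sigma_{i+1}$); $\mathrm{des}(\sigma)$ and $\mathrm{asc}(\sigma)$ are the numbers of descents and ascents. $\mathrm{PRW}_n$ is the set of $\pi\in\mathfrak{S}_n$ such that the first ascent (if any) of $\pi$ appears at the letter $1$; i.e., if $\pi$ has an ascent and $i$ is the smallest one, then $\pi_i=1$. A left-to-right minimum (resp. right-to-left minimum) of $\sigma\in\mathfrak{S}_n$ is a letter $\sigma_i$ such that $\sigma_j>\sigma_i$ for every $j<i$ (resp. every $j>i$); $\mathrm{LRmin}(\sigma)$ and $\mathrm{RLmin}(\sigma)$ are the numbers of these. With the convention $\sigma_0=\sigma_{n+1}=+\infty$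 for $\sigma\in\mathfrak{S}_n$, a value $\sigma_i$ ($1\le i\le n$) is a peak if $\sigma_{i-1}<\sigma_i>\sigma_{i+1}$; $\mathrm{M}(\sigma)$ is the number of peaks of $\sigma$. In the formulas for $x$ and $y$, the same (fixed) square root of $(w+v)^2-4uvw$ is used. *)

(* Defs.v *)
From mathcomp Require Import all_boot all_order all_fingroup all_algebra.

Set Implicit Arguments.
Unset Strict Implicit.
Unset Printing Implicit Defensive.

Section PermutationStatistics.

Variables (n : nat) (s : 'S_n).

(* 'S_n permutes {0, ..., n-1}: both positions and values are shifted by one,  *)
(* so that letter k is sigma_k in {1, ..., n} for 1 <= k <= n.  Outside of     *)
(* that range it is n.+1, which exceeds every letter and stands for the        *)
(* convention sigma_0 = sigma_{n+1} = +oo.                                     *)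
Definition letter (k : nat) : nat :=
  nth n.+1 (n.+1 :: [seq (s i).+1 | i <- enum 'I_n]) k.

(* Index sequences are increasing, with indices in [n-1] for descents and     *)
(* ascents and in [n] for the other statistics.                               *)
Definition descents : seq nat :=
  [seq i <- index_iota 1 n | letter i.+1 < letter i].

Definition ascents : seq nat :=
  [seq i <- index_iota 1 n | letter i < letter i.+1].

Definition des : nat := size descents.
Definition asc : nat := size ascents.

Definition peaks : nat :=
  count (fun i => (letter i.-1 < letter i) && (letter i.+1 < letter i))
        (index_iota 1 n.+1).

Definition LRmin : nat :=
  count (fun i => all (fun j => letter i < letter j) (index_iota 1 i))
        (index_iota 1 n.+1).

Definition RLmin : nat :=
  count (fun i => all (fun j => letter i < letter j) (index_iota i.+1 n.+1))
        (index_iota 1 n.+1).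

End PermutationStatistics.

Definition PRW (n : nat) : {set 'S_n} :=
  [set s : 'S_n | if ascents s is i :: _ then letter s i == 1 else true].

(* Main.v *)
(* A permutation in PRW_(n+1) is a decreasing prefix followed by 1 and an       *)

(* That F_n depends only on these invariants is expressed as: parameters with equal invariants give
   equal sums ([sum_weight_invariants]). The induction on n ranges over all commutative rings at
   once: D F_n is the eps part of F_n over the dual numbers, and parameters with equal invariants
   keep equal invariants once D supplies their eps parts, so the induction hypothesis applies to
   them too. The recurrence is proved word by word in [sum_weight_insertions]; [sum_PRW_weight]
   identifies F_n at q = v with the sum over PRW. *)
(* arbitrary word. Give the descents of the prefix (that of its last letter     *)
(* onto 1 included) their own weight q, and let F_n be the weighted sum.        *)
(* Inserting a new largest letter stays in PRW only at the front, at the end,   *)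
(* or in a gap after 1, and yields                                              *)
(*   F_(n+1) = alpha (q + w) F_n + D F_n,                                       *)
(* where D is the derivation with D u = u (1 - u) (v + w), D v = D w = u v w,   *)
(* D q = D alpha = 0. With Z = u v w, D maps v + w to 2 Z, q + w to Z and Z to  *)
(* Z (v + w), so F_n depends only on alpha, v + w, q + w and u v w. At q = v    *)
(* these are unchanged when (u, v, w) is replaced by (1, x, y), since x + y =   *)
(* v + w and x y = u v w.                                                       *)
From HB Require Import structures.
Require Import Defs.
From mathcomp Require Import all_boot all_order all_fingroup all_algebra.
From mathcomp Require Import ring.
Import GRing.Theory.
Local Open Scope ring_scope.

Set Implicit Arguments.
Unset Strict Implicit.
Unset Printing Implicit Defensive.

(* D is realized by evaluating at dual numbers: F(a + D a eps) = F(a) + D F(a) eps. *)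
Definition dual_number (R : comNzRingType) : Type := (R * R)%type.

Section DualNumberRing.

Variable R : comNzRingType.
Local Notation dual := (dual_number R).

HB.instance Definition _ := GRing.Zmodule.copy dual (R * R)%type.

Definition dual_one : dual := (1, 0).
Definition dual_mul (a b : dual) : dual := (a.1 * b.1, a.1 * b.2 + a.2 * b.1).

Lemma dual_mulA : associative dual_mul.
Proof. by move=> [a a'] [b b'] [c c']; congr pair => /=; ring. Qed.

Lemma dual_mulC : commutative dual_mul.
Proof. by move=> [a a'] [b b']; congr pair => /=; ring. Qed.

Lemma dual_mul1 : left_id dual_one dual_mul.
Proof. by move=> [a a']; congr pair => /=; ring. Qed.

Lemma dual_mulDl : left_distributive dual_mul +%R.
Proof. by move=> [a a'] [b b'] [c c']; congr pair => /=; ring. Qed.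

Lemma dual_one_neq0 : dual_one != 0.
Proof. by apply/eqP => -[] /eqP; rewrite oner_eq0. Qed.

HB.instance Definition _ := GRing.Zmodule_isComNzRing.Build dual
  dual_mulA dual_mulC dual_mul1 dual_mulDl dual_one_neq0.

End DualNumberRing.

(** * Weights of words and insertion of letters *)

Section Weight.

Variables (R : comNzRingType) (u v w q alpha : R).

(* At the last letter [head b s' < b] is [b < b]: it is never a peak, as the    *)
(* convention sigma_(n+1) = +oo requires.                                       *)
Fixpoint suffix_weight (a : nat) (s : seq nat) : R :=
  if s is b :: s' then
    (if (a < b)%N then w else v) * u ^+ ((a < b) && (head b s' < b))%N
      * alpha ^+ all (ltn b) s' * suffix_weight b s'
  else 1.

(* Words outside PRW, or without the letter 1, get 0.  *)
Fixpoint weight (s : seq nat) : R :=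
  if s is a :: s' then
    if a == 1%N then suffix_weight 1 s'
    else if (head a s' < a)%N then q * alpha * weight s' else 0
  else 0.

End Weight.

Fixpoint insertions (m : nat) (s : seq nat) : seq (seq nat) :=
  (m :: s) :: (if s is a :: s' then [seq a :: t | t <- insertions m s'] else [::]).

Fixpoint perm_words (n : nat) : seq (seq nat) :=
  if n is k.+1 then flatten [seq insertions n t | t <- perm_words k] else [:: [::]].

Lemma insertions_tl m s :
  insertions m s = (m :: s) :: behead (insertions m s).
Proof. by case: s. Qed.

Lemma all_insertions (p : pred nat) m s t : p m -> t \in insertions m s -> all p t = all p s.
Proof.
move=> pm; elim: s t => [|a s IHs] t /=.
  by rewrite inE => /eqP ->; rewrite /= pm.
rewrite inE => /orP[/eqP ->|/mapP[t' t't ->]]; first by rewrite /= pm.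
by rewrite /= (IHs t').
Qed.

Lemma head_behead_insertions x m s t :
  t \in behead (insertions m s) -> head x t = head x s.
Proof. by case: s => //= a s /mapP[t' _ ->]. Qed.

(** * Inserting a new largest letter *)

Section InsertMax.

Variables (R : comNzRingType) (u v w q alpha : R).

Let wt := weight u v w q alpha.
Let swt := suffix_weight u v w alpha.

Let du : dual_number R := (u, u * (1 - u) * (v + w)).
Let dv : dual_number R := (v, u * v * w).
Let dw : dual_number R := (w, u * v * w).
Let dq : dual_number R := (q, 0).
Let dalpha : dual_number R := (alpha, 0).

Let dwt := weight du dv dw dq dalpha.
Let dswt := suffix_weight du dv dw dalpha.

Lemma dual_suffix_weight1 a s : (dswt a s).1 = swt a s.
Proof.
rewrite /dswt /swt; elim: s a => [|b s IHs] a //=.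
rewrite -(IHs b).
by case: (a < b)%N; case: (head b s < b)%N; case: (all _ _).
Qed.

Lemma dual_weight1 s : (dwt s).1 = wt s.
Proof.
rewrite /dwt /wt; elim: s => [|a s IHs] //=.
case: ifP => _; first exact: dual_suffix_weight1.
by case: ifP => _ //=; rewrite -IHs.
Qed.

(** At the end, [m] adds an ascent and a right-to-left minimum: [alpha * w]. In any other gap
    right-to-left minima do not change, and a step [v] or [w] becomes an ascent and a descent around
    the peak [m]: [u * v * w]. Beside an old peak, that peak is lost and the new [u] merely replaces
    its [u]; D u corrects the two gaps beside each peak. *)
Lemma sum_suffix_weight_insertions m a s : (a < m)%N -> all (gtn m) s ->
  \sum_(t <- insertions m s) swt a t = alpha * w * swt a s + (dswt a s).2.
Proof.
elim: s a => [|b s IHs] a am.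
  by move=> _; rewrite /= big_seq1 /swt /dswt /= am ltnn /=; ring.
move=> /= /andP[bm sm].
have := IHs b bm sm; rewrite {2}insertions_tl !big_cons big_map.
rewrite insertions_tl big_cons.
(* Insertion just after [b] can destroy the peak at [b], so it is separated; the insertions in
   [rest] keep the head of [s] and hence the factor of [b]. *)
set rest := \sum_(t <- behead _) swt b t => IH.
have -> : \sum_(t <- behead (insertions m s)) swt a (b :: t)
    = (if (a < b)%N then w else v) * u ^+ ((a < b) && (head b s < b))%N
        * alpha ^+ all (ltn b) s * rest.
  rewrite /rest big_distrr big_seq [RHS]big_seq; apply: eq_bigr => t ti /=.
  rewrite /swt /= (head_behead_insertions _ ti).
  by rewrite (@all_insertions _ m s) // insertions_tl inE ti orbT.
have {IH} -> : rest = alpha * w * swt b s + (dswt b s).2 - swt b (m :: s).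
  by rewrite -IH; ring.
have bNm : (m < b)%N = false by rewrite ltnNge ltnW.
have D1 := dual_suffix_weight1 b s.
rewrite /swt /dswt /= am bm bNm /= -/swt -/dswt ?andbF.
case: (dswt b s) D1 => _ D' /= ->.
case: s sm {IHs rest} => [|c s] /=.
  by move=> _; rewrite !ltnn /= andbF; case: (a < b)%N => /=; ring.
move=> /andP[cm _]; rewrite cm.
have -> : (m < c)%N = false by rewrite ltnNge ltnW.
rewrite /swt /= -/swt.
have cb_neg : (c < b)%N -> (b < c)%N = false by move=> cb; rewrite ltnNge ltnW.
case: (a < b)%N; case: (c < b)%N cb_neg => [-> //|_];
  case: (all (ltn b) s); case: (all (ltn c) s); try case: (b < c)%N;
  rewrite /=; ring.
Qed.

(** Before 1 only the front is admissible; it adds a prefix descent and a left-to-right minimum,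
    [q * alpha]. Any other gap there creates an ascent before 1, of weight 0. The gaps after 1 give
    [alpha * w] and D. *)
Lemma sum_weight_insertions m s : 1%N \in s -> all (gtn m) s ->
  \sum_(t <- insertions m s) wt t = alpha * (q + w) * wt s + (dwt s).2.
Proof.
elim: s => [|a s IHs] //= s1 /andP[am sm].
have m_gt1 : (1 < m)%N.
  by move: s1; rewrite inE => /predU1P[->|/(allP sm)].
have aNm : (m < a)%N = false by rewrite ltnNge ltnW.
have wt_m s' : all (gtn m) s' -> 1%N \in s' -> wt (m :: s') = q * alpha * wt s'.
  by rewrite /wt; case: s' => //= b s' /andP[-> _] _; rewrite gtn_eqF.
rewrite big_cons big_map wt_m /= ?am //.
have [a1|a1] := eqVneq a 1%N.
  by rewrite sum_suffix_weight_insertions // /swt /dswt; ring.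
have {}s1 : 1%N \in s by move: s1; rewrite inE eq_sym (negPf a1).
have := IHs s1 sm; rewrite insertions_tl !big_cons wt_m //.
set rest := \sum_(t <- behead _) wt t => IH.
have -> : \sum_(t <- behead (insertions m s))
      (if (head a t < a)%N then q * alpha * wt t else 0)
    = if (head a s < a)%N then q * alpha * rest else 0.
  case: ifP => sa; rewrite ?big_distrr big_seq ?[RHS]big_seq.
    by apply: eq_bigr => t ti; rewrite (head_behead_insertions _ ti) sa.
  by rewrite big1 // => t ti; rewrite (head_behead_insertions _ ti) sa.
have {IH} -> : rest = alpha * w * wt s + (dwt s).2.
  (* The front insertion into [s] would land after [a], so its term is removed from the induction
     hypothesis. *)
  by apply: (addrI (q * alpha * wt s)); rewrite IH; ring.
rewrite /= aNm; case: ifP => _ /=; last by ring.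
by rewrite dual_weight1; ring.
Qed.

End InsertMax.

(** * The recurrence for the total weight and its invariants *)

Lemma perm_words_bounds n t : t \in perm_words n.+1 ->
  (1%N \in t) && all (gtn n.+2) t.
Proof.
elim: n t => [|n IHn] t; first by rewrite inE => /eqP ->.
move=> /flatten_mapP[s /IHn /andP[s1 sn] ts].
rewrite -has_pred1 -[has _ _]negbK -all_predC.
rewrite (@all_insertions (predC (pred1 1%N)) _ _ _ _ ts) //.
rewrite all_predC negbK has_pred1 s1 (all_insertions _ ts) //=.
by apply: sub_all sn => k /= kn; rewrite ltnW.
Qed.

Lemma sum_weight_invariants n (R : comNzRingType)
    (u v w q u' v' w' q' alpha : R) :
  v + w = v' + w' -> q + w = q' + w' -> u * v * w = u' * v' * w' ->
  \sum_(t <- perm_words n.+1) weight u v w q alpha t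
  = \sum_(t <- perm_words n.+1) weight u' v' w' q' alpha t.
Proof.
elim: n R u v w q u' v' w' q' alpha => [|n IHn] R u v w q u' v' w' q' alpha.
  by rewrite /= !big_seq1.
move=> vw qw uvw.
have sum_step u0 v0 w0 q0 :
    \sum_(t <- perm_words n.+2) weight u0 v0 w0 q0 alpha t
    = alpha * (q0 + w0)
        * \sum_(t <- perm_words n.+1) weight u0 v0 w0 q0 alpha t
      + (\sum_(t <- perm_words n.+1)
           weight ((u0, u0 * (1 - u0) * (v0 + w0)) : dual_number R)
             ((v0, u0 * v0 * w0) : dual_number R)
             ((w0, u0 * v0 * w0) : dual_number R)
             ((q0, 0) : dual_number R) ((alpha, 0) : dual_number R) t).2.
  rewrite [perm_words n.+2]/= big_flatten big_map big_distrr /=.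
  rewrite (big_morph (fun z : dual_number R => z.2) (id1 := 0) (op1 := +%R)) //.
  rewrite -big_split big_seq [RHS]big_seq; apply: eq_bigr => t.
  move=> /perm_words_bounds /andP[t1 tn].
  exact: sum_weight_insertions.
rewrite !sum_step qw (IHn _ u v w q u' v' w' q') //.
congr (_ + _.2); apply: (IHn (dual_number R)).
- by congr pair => //=; rewrite uvw.
- by congr pair => //=; rewrite uvw.
apply: (congr2 pair) => //=.
transitivity (u * v * w * (v + w)); first by ring.
by rewrite uvw vw; ring.
Qed.

Definition word (n : nat) (s : 'S_n) : seq nat := [seq (s i).+1 | i <- enum 'I_n].

Lemma size_word n (s : 'S_n) : size (word s) = n.
Proof. by rewrite size_map -cardE card_ord. Qed.

Lemma word_inj n : injective (@word n).
Proof.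
move=> s t /eq_in_map st; apply/permP => i.
by apply/val_inj/succn_inj/st; rewrite mem_enum.
Qed.

Lemma word_perm_eq n (s : 'S_n) : perm_eq (word s) (iota 1 n).
Proof.
have word_uniq : uniq (word s).
  by rewrite map_inj_uniq ?enum_uniq // => i j [] /val_inj /perm_inj.
apply: uniq_perm; rewrite ?iota_uniq //.
apply: (uniq_min_size word_uniq _ _).2; last by rewrite size_iota size_word.
by move=> _ /mapP[i _ ->]; rewrite mem_iota /= add1n ltnS.
Qed.

Lemma mem_insertions m s1 s2 : s1 ++ m :: s2 \in insertions m (s1 ++ s2).
Proof.
elim: s1 => [|a s1 IHs]; first by rewrite insertions_tl mem_head.
by rewrite /= inE map_f ?orbT.
Qed.

Lemma mem_perm_words n t : perm_eq t (iota 1 n) -> t \in perm_words n.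
Proof.
elim: n t => [|n IHn] t; first by move=> /perm_nilP ->.
have -> : iota 1 n.+1 = iota 1 n ++ [:: n.+1].
  by rewrite -[[:: _]]/(iota (1 + n) 1) -iotaD addn1.
rewrite perm_sym perm_catC perm_sym => tn.
have n_in : n.+1 \in t by rewrite (perm_mem tn) mem_head.
case/splitPr: t / n_in tn => t1 t2.
rewrite perm_catC perm_cons perm_catC => tn.
apply/flatten_mapP; exists (t1 ++ t2); last exact: mem_insertions.
exact: IHn.
Qed.

Lemma size_insertions m s : size (insertions m s) = (size s).+1.
Proof. by elim: s => //= a s IHs; rewrite size_map IHs. Qed.

Lemma size_mem_insertions m s t : t \in insertions m s -> size t = (size s).+1.
Proof.
elim: s t => [|a s IHs] t /=; first by rewrite inE => /eqP ->.
by rewrite inE => /predU1P[->|/mapP[t' /IHs t's ->]] //=; rewrite t's.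
Qed.

Lemma size_mem_perm_words n t : t \in perm_words n -> size t = n.
Proof.
elim: n t => [|n IHn] t; first by rewrite inE => /eqP ->.
by move=> /flatten_mapP[s /IHn <- /size_mem_insertions].
Qed.

Lemma size_perm_words n : size (perm_words n) = n`!.
Proof.
elim: n => [|n IHn] //.
rewrite [perm_words _]/= size_flatten /shape -map_comp sumnE big_map.
rewrite big_seq (eq_bigr (fun=> n.+1)); last first.
  by move=> t /size_mem_perm_words /= tn; rewrite -tn size_insertions tn.
by rewrite -big_seq big_const_seq count_predT IHn iter_addn_0 factS.
Qed.

Lemma perm_words_enum n : perm_eq [seq word s | s : 'S_n] (perm_words n).
Proof.
have enum_word_uniq : uniq [seq word s | s : 'S_n].
  by rewrite map_inj_uniq ?enum_uniq //; apply: word_inj.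
have sub : {subset [seq word s | s : 'S_n] <= perm_words n}.
  by move=> _ /mapP[s _ ->]; apply/mem_perm_words/word_perm_eq.
have le : (size (perm_words n) <= size [seq word s | s : 'S_n])%N.
  by rewrite size_perm_words size_map -cardE card_Sn.
apply: uniq_perm => //; first exact: leq_size_uniq le.
exact: (uniq_min_size _ _ le).2.
Qed.

Fixpoint des_from (a : nat) (s : seq nat) : nat :=
  if s is b :: s' then ((b < a) + des_from b s')%N else 0%N.

Fixpoint asc_from (a : nat) (s : seq nat) : nat :=
  if s is b :: s' then ((a < b) + asc_from b s')%N else 0%N.

Fixpoint peaks_from (a : nat) (s : seq nat) : nat :=
  if s is b :: s' then (((a < b) && (head b s' < b)) + peaks_from b s')%N else 0%N.

Fixpoint rl_minima (s : seq nat) : nat :=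
  if s is b :: s' then (all (ltn b) s' + rl_minima s')%N else 0%N.

Definition lr_minima (x : nat) (s : seq nat) : nat :=
  count (fun i => all (fun j => nth x s i < nth x s j)%N (iota 0 i))
    (iota 0 (size s)).

Fixpoint prw (a : nat) (s : seq nat) : bool :=
  if s is b :: s' then if (a < b)%N then a == 1%N else prw b s' else true.

Lemma count_iotaS (p : pred nat) m n :
  count p (iota m.+1 n) = count (fun i => p i.+1) (iota m n).
Proof. by rewrite (iotaDl 1 m n) count_map. Qed.

Lemma all_iotaS (p : pred nat) m n :
  all p (iota m.+1 n) = all (fun i => p i.+1) (iota m n).
Proof. by rewrite (iotaDl 1 m n) all_map. Qed.

Lemma all_nth_iota (p : pred nat) x s :
  all (fun j => p (nth x s j)) (iota 0 (size s)) = all p s.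
Proof. by rewrite -[in RHS](mkseq_nth x s) all_map. Qed.

Lemma count_des_from x a s :
  count (fun i => nth x (a :: s) i.+1 < nth x (a :: s) i)%N (iota 0 (size s))
  = des_from a s.
Proof. by elim: s a => //= b s IHs a; rewrite count_iotaS -IHs. Qed.

Lemma count_asc_from x a s :
  count (fun i => nth x (a :: s) i < nth x (a :: s) i.+1)%N (iota 0 (size s))
  = asc_from a s.
Proof. by elim: s a => //= b s IHs a; rewrite count_iotaS -IHs. Qed.

Lemma count_peaks_from x a s : all (gtn x) s ->
  count (fun i => (nth x (a :: s) i < nth x (a :: s) i.+1)
                && (nth x (a :: s) i.+2 < nth x (a :: s) i.+1))%N
    (iota 0 (size s))
  = peaks_from a s.
Proof.
elim: s a => //= b s IHs a /andP[bx sx]; rewrite count_iotaS -IHs //.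
congr (nat_of_bool (_ && _) + _)%N.
by case: s {IHs sx} => //=; rewrite ltnn ltnNge ltnW.
Qed.

Lemma count_rl_minima x s :
  count (fun i => all (fun j => nth x s i < nth x s j)%N
                    (iota i.+1 (size s - i.+1))) (iota 0 (size s))
  = rl_minima s.
Proof.
elim: s => //= b s IHs; rewrite count_iotaS -IHs subSS subn0 all_iotaS.
congr (nat_of_bool _ + _)%N; first by rewrite (all_nth_iota (ltn b)).
by apply: eq_count => i; rewrite subSS all_iotaS.
Qed.

Lemma first_ascent_prw x a s :
  (if [seq i <- iota 0 (size s) | nth x (a :: s) i < nth x (a :: s) i.+1]%N
     is i :: _ then nth x (a :: s) i == 1%N else true) = prw a s.
Proof.
elim: s a => //= b s IHs a; case: ifP => //= _; rewrite -IHs.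
rewrite (iotaDl 1 0) filter_map.
by set l := filter _ _; case: l.
Qed.

Lemma lr_minima_cons x a s :
  lr_minima x (a :: s)
  = (count (fun i => (nth x s i < a)
             && all (fun j => nth x s i < nth x s j) (iota 0 i))
       (iota 0 (size s))).+1%N.
Proof.
rewrite /lr_minima /= add1n count_iotaS; congr _.+1.
by apply: eq_count => i /=; rewrite all_iotaS.
Qed.

Lemma lr_minima_cons_gt x a b s : (b < a)%N ->
  lr_minima x [:: a, b & s] = (lr_minima x (b :: s)).+1.
Proof.
move=> ba; rewrite lr_minima_cons; congr _.+1; apply: eq_count => -[|i] /=.
  by rewrite ba.
case: (ltnP _ b) => [ib|_]; last by rewrite /= andbF.
by rewrite (ltn_trans ib ba).
Qed.

Lemma lr_minima_cons_min x a s : all (ltn a) s -> lr_minima x (a :: s) = 1%N.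
Proof.
move=> sa; rewrite lr_minima_cons (@eq_in_count _ _ pred0) ?count_pred0 //.
move=> i; rewrite mem_iota => /andP[_ i_s] /=.
by have /(allP sa) /ltnW := mem_nth x i_s; rewrite leqNgt => /negPf ->.
Qed.

Lemma lr_minima_gt0 x a s : (0 < lr_minima x (a :: s))%N.
Proof. by rewrite lr_minima_cons. Qed.

Lemma rl_minima_gt0 a s : (0 < rl_minima (a :: s))%N.
Proof. by elim: s a => //= b s IHs a; rewrite ltn_addl. Qed.

Section Statistics.

Variables (n : nat) (s : 'S_n) (a : nat) (t : seq nat).
Hypothesis s_word : word s = a :: t.

Let letterE k : letter s k.+1 = nth n.+1 (a :: t) k.
Proof. by rewrite -s_word. Qed.

Let nE : n = (size t).+1.
Proof. by rewrite -(size_word s) s_word. Qed.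

Let tn : all (gtn n.+1) (a :: t).
Proof.
rewrite -s_word (perm_all _ (word_perm_eq s)); apply/allP => i.
by rewrite mem_iota add1n => /andP[].
Qed.

Lemma des_word : des s = des_from a t.
Proof.
rewrite /des /descents size_filter /index_iota count_iotaS subn1.
rewrite -(count_des_from n.+1) [in iota _ _]nE.
by apply: eq_count => i /=; rewrite !letterE.
Qed.

Lemma asc_word : asc s = asc_from a t.
Proof.
rewrite /asc /ascents size_filter /index_iota count_iotaS subn1.
rewrite -(count_asc_from n.+1) [in iota _ _]nE.
by apply: eq_count => i /=; rewrite !letterE.
Qed.

Lemma peaks_word : peaks s = peaks_from a t.
Proof.
transitivity (peaks_from n.+1 (a :: t)); last first.
  by move: tn => /= /andP[an _]; rewrite ltnNge ltnW.
rewrite -(@count_peaks_from n.+1) // /peaks /index_iota count_iotaS subn1.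
by rewrite -s_word size_word.
Qed.

Lemma LRmin_word : LRmin s = lr_minima n.+1 (a :: t).
Proof.
rewrite /LRmin /lr_minima /index_iota count_iotaS subn1 -s_word size_word.
by apply: eq_count => i /=; rewrite subn1 all_iotaS.
Qed.

Lemma RLmin_word : RLmin s = rl_minima (a :: t).
Proof.
rewrite -(count_rl_minima n.+1) /RLmin /index_iota count_iotaS.
rewrite subn1 -s_word size_word.
by apply: eq_count => i /=; rewrite subSS all_iotaS.
Qed.

Lemma PRW_word : (s \in PRW n) = prw a t.
Proof.
rewrite inE -(first_ascent_prw n.+1) /ascents /index_iota subn1.
rewrite (iotaDl 1 0) filter_map [in iota _ _]nE /=.
under eq_filter => i do rewrite /= !letterE.
by case: filter => //= i _; rewrite letterE.
Qed.

End Statistics.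

Section WeightStatistics.

Variables (R : comNzRingType) (u v w alpha : R).

Lemma suffix_weight_stats a s : uniq (a :: s) ->
  suffix_weight u v w alpha a s
  = u ^+ peaks_from a s * v ^+ des_from a s * w ^+ asc_from a s
      * alpha ^+ rl_minima s.
Proof.
elim: s a => [|b s IHs] a; first by rewrite /= !mulr1.
move=> /= /andP[]; rewrite inE negb_or => /andP[ab _] /IHs ->.
rewrite !exprD; move: ab; case: ltngtP => //= _ _; ring.
Qed.

Lemma weight_stats x a s : uniq (a :: s) -> 1%N \in a :: s -> 0%N \notin a :: s ->
  weight u v w v alpha (a :: s)
  = if prw a s then
      u ^+ peaks_from a s * v ^+ des_from a s * w ^+ asc_from a s
        * alpha ^+ (lr_minima x (a :: s) + rl_minima (a :: s) - 2)
    else 0.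
Proof.
elim: s a => [|b s IHs] a us.
  by rewrite inE => /eqP <- _; rewrite /= !mulr1.
have [a1 _|a1] := eqVneq a 1%N.
  subst a; rewrite inE negb_or => /andP[_ bs_gt0].
  have min1 : all (ltn 1) (b :: s).
    apply/allP => -[|[|k]] //= k_s; first by rewrite k_s in bs_gt0.
    by move: us; rewrite cons_uniq k_s.
  rewrite -[weight _ _ _ _ _ _]/(suffix_weight u v w alpha 1 (b :: s)).
  rewrite suffix_weight_stats // lr_minima_cons_min //.
  rewrite -[rl_minima (1%N :: _)]/(all (ltn 1) (b :: s) + rl_minima (b :: s))%N.
  have b_gt1 : (1 < b)%N := allP min1 b (mem_head b s).
  by rewrite [prw _ _]/= b_gt1 min1 addnA addKn.
have -> : weight u v w v alpha [:: a, b & s]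
    = if (b < a)%N then v * alpha * weight u v w v alpha (b :: s) else 0.
  by rewrite [LHS]/= (negPf a1).
rewrite in_cons eq_sym (negPf a1) orFb => s1.
rewrite in_cons negb_or => /andP[_ s0].
move: us; rewrite cons_uniq in_cons negb_or => /andP[/andP[ab _] us].
rewrite IHs // [prw a _]/= (negPf a1).
case: ltngtP ab => // ba _.
case: ifP => _; last by rewrite mulr0.
have L_gt0 := lr_minima_gt0 x b s; have := rl_minima_gt0 b s.
rewrite (lr_minima_cons_gt _ _ ba).
move: (lr_minima x (b :: s)) L_gt0 => L L_gt0 /=.
rewrite ba (ltnNge a) (ltnW ba) /=.
move: (_ + rl_minima s)%N => r r_gt0.
rewrite !add0n addSn subSn ?exprS; last by rewrite -[2%N]/(1 + 1)%N leq_add.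
ring.
Qed.

End WeightStatistics.

Lemma sum_PRW_weight (R : comNzRingType) (u v w alpha : R) n :
  \sum_(s in PRW n.+1)
     u ^+ peaks s * v ^+ des s * w ^+ asc s * alpha ^+ (LRmin s + RLmin s - 2)
  = \sum_(t <- perm_words n.+1) weight u v w v alpha t.
Proof.
rewrite -(perm_big _ (perm_words_enum n.+1)) big_map big_mkcond /=.
rewrite big_enum_cond.
apply: eq_bigr => s _.
case s_word : (word s) (word_perm_eq s) (size_word s) => [|a t] // st _.
rewrite (PRW_word s_word) (peaks_word s_word) (des_word s_word).
rewrite (asc_word s_word) (LRmin_word s_word) (RLmin_word s_word) -weight_stats //.
- by rewrite (perm_uniq st) iota_uniq.
- by rewrite (perm_mem st) mem_iota.
- by rewrite (perm_mem st) mem_iota.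
Qed.

Theorem theorem2p2 (R : comUnitRingType) (h2 : (2 : R) \is a GRing.unit)
    (u v w alpha r x y : R)
    (hr : r ^+ 2 = (w + v) ^+ 2 - 4 * u * v * w)
    (hx : x = ((w + v) - r) / 2)
    (hy : y = ((w + v) + r) / 2)
    (n : nat) (hn : (1 <= n)%N) :
  \sum_(s in PRW n.+1)
     u ^+ peaks s * v ^+ des s * w ^+ asc s * alpha ^+ (LRmin s + RLmin s - 2)
  = \sum_(s in PRW n.+1)
     x ^+ des s * y ^+ asc s * alpha ^+ (LRmin s + RLmin s - 2).
Proof.
have x2 : x * 2 = w + v - r by rewrite hx divrK.
have y2 : y * 2 = w + v + r by rewrite hy divrK.
have xy_sum : v + w = x + y.
  by apply: (mulIr h2); rewrite mulrDl [RHS]mulrDl x2 y2; ring.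
have xy_prod : u * v * w = 1 * x * y.
  apply: (mulIr h2); apply: (mulIr h2).
  have -> : 1 * x * y * 2 * 2 = (x * 2) * (y * 2) by ring.
  have -> : x * 2 * (y * 2) = (w + v) ^+ 2 - r ^+ 2 by rewrite x2 y2; ring.
  by rewrite hr; ring.
rewrite sum_PRW_weight (sum_weight_invariants n alpha xy_sum xy_sum xy_prod).
rewrite -sum_PRW_weight; apply: eq_bigr => s _.
by rewrite expr1n mul1r.
Qed.
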